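(* Let $n \geq 1$, let $H_0 \in \mathbb{C}^{n \times n}$ be Hermitian, let $V=\mathrm{diag}(v_1,\dots,v_n) \in \mathbb{R}^{n \times n}$ be a real diagonal matrix, and set $H := H_0+V$. Suppose that there exists $s>0$ such that $s\mathrm{I} - H_0$ is a nonnegative matrix, and suppose that $\boldsymbol{1} \in \mathbb{R}^n$ is an eigenvector associated with the lowest eigenvalue of $H_0$. Then $H_0$ and $H$ are isospectral if and only if $V=0$.
   Context: $\mathrm{I} \in \mathbb{R}^{n\times n}$ is the identity matrix and $\boldsymbol{1}$ is the vector with all components equal to one. A matrix is nonnegative if all its entries are real and $\geq 0$. Two Hermitian matrices in $\mathbb{C}^{n\times n}$ are called isospectral if and only if they have the same eigenvalues, counted with multiplicities. *)

(* Defs.v *)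
From HB Require Import structures.
From mathcomp Require Import all_boot all_order all_algebra.
From mathcomp Require Import sesquilinear.
From mathcomp Require Import complex.
From mathcomp Require Import reals.
Set Implicit Arguments.
Unset Strict Implicit.
Unset Printing Implicit Defensive.
Import Order.TTheory GRing.Theory Num.Theory.
Local Open Scope ring_scope.

(* MathComp's [eigenspace] consists of left (row) eigenvectors; this is the
   usual column convention. *)
Definition eigenvector (F : fieldType) (n : nat) (A : 'M[F]_n) (a : F)
    (x : 'cV[F]_n) : Prop :=
  x != 0 /\ A *m x = a *: x.

(* On R[i], [a <= b] means that b - a is real and nonnegative; on the
   spectrum of a Hermitian matrix, which is real, it is the usual order. *)
Definition lowest_eigenvalue (C : numFieldType) (n : nat) (A : 'M[C]_n)
    (a : C) : Prop :=
  eigenvalue A a /\ forall b : C, eigenvalue A b -> a <= b.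

(* Non-eigenvalues have multiplicity 0 on both sides. *)
Definition isospectral (F : fieldType) (n : nat) (A B : 'M[F]_n) : Prop :=
  forall a : F, mup a (char_poly A) = mup a (char_poly B).

(* Main.v *)
Require Import Defs.
From HB Require Import structures.
From mathcomp Require Import all_boot all_order all_algebra.
From mathcomp Require Import sesquilinear.
From mathcomp Require Import complex.
From mathcomp Require Import reals.
Set Implicit Arguments.
Unset Strict Implicit.
Unset Printing Implicit Defensive.
Import Order.TTheory GRing.Theory Num.Theory.
Local Open Scope ring_scope.
Local Open Scope complex_scope.

(** The argument is variational.  Isospectral matrices have the same trace
    ([isospectral_trace]), so the entries of v sum to 0, and hence the quadratic
    form of H takes at the constant vector 1 the same value as that of H0,
    namely a n, where a is the lowest eigenvalue of H0.  Since a is also the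
    lowest eigenvalue of H, the vector 1 minimises the Rayleigh quotient of H,
    and a minimiser is an eigenvector ([hermitian_rayleigh_min]).  So
    H 1 = a 1 = H0 1, that is V 1 = 0; the entries of V 1 are those of v. *)

(** Over an algebraically closed field a monic polynomial is the product of
    its linear factors, so the multiplicities of its roots determine it. *)
Lemma isospectral_char_poly (F : closedFieldType) (n : nat) (A B : 'M[F]_n) :
  isospectral A B -> char_poly A = char_poly B.
Proof.
rewrite /isospectral => AB.
have [r Ar] := closed_field_poly_normal (char_poly A).
have [s Bs] := closed_field_poly_normal (char_poly B).
move: Ar Bs AB.
rewrite !(monicP (char_poly_monic _)) !scale1r => -> -> rs.
by apply: perm_big; apply/allP => x _ /=; rewrite -!mu_prod_XsubC rs.
Qed.

Lemma isospectral_trace (F : closedFieldType) (n : nat) (A B : 'M[F]_n) :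
  isospectral A B -> \tr A = \tr B.
Proof.
case: n A B => [|n] A B AB; first by rewrite (flatmx0 A) (flatmx0 B).
by apply: oppr_inj; rewrite -!char_poly_trace // (isospectral_char_poly AB).
Qed.

Section Hermitian.

Local Open Scope sesquilinear_scope.

Lemma diag_quad_form (C : numClosedFieldType) (n : nat) (d : 'rV[C]_n)
    (w : 'cV[C]_n) :
  w^t* *m diag_mx d *m w = (\sum_i d 0 i * `|w i 0| ^+ 2)%:M.
Proof.
apply/matrixP => i j; rewrite !ord1 !mxE mulr1n.
apply: eq_bigr => k _; rewrite mul_mx_diag !mxE normCK.
by rewrite -mulrA mulrC -mulrA.
Qed.

(** In the coordinates w of x along an orthonormal eigenbasis, the hypothesis
    on the quadratic form reads: the (d_i - a) |w_i|^2 sum to 0.  They are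
    nonnegative, so w_i vanishes wherever the eigenvalue d_i exceeds a. *)
Lemma hermitian_rayleigh_min (C : numClosedFieldType) (n : nat) (A : 'M[C]_n)
    (a : C) (x : 'cV[C]_n) :
    A \is hermsymmx -> (forall b, eigenvalue A b -> a <= b) ->
    x^t* *m A *m x = a *: (x^t* *m x) ->
  A *m x = a *: x.
Proof.
move=> /hermitian_normalmx /orthomx_spectralP.
set P := spectralmx A; set d := spectral_diag A => A_PdP a_min xAx.
have PU : P \is unitarymx := spectral_unitarymx A.
have PPt : P *m P^t* = 1%:M by apply/unitarymxP.
have PtP : P^t* *m P = 1%:M by rewrite mulmx1C.
rewrite (invmx_unitary PU) in A_PdP.
have d_ge i : a <= d 0 i.
  apply: a_min; apply/eigenvalueP; exists (row i P).
    rewrite A_PdP !mulmxA -row_mul PPt row1 -[RHS]mul_scalar_mx rowE !mulmxA.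
    congr (_ *m _); rewrite mul_mx_diag mul_scalar_mx.
    apply/matrixP => j k; rewrite !mxE.
    by case: (k =P i) => [->|_]; rewrite ?andbF ?mulr0 ?mul0r // mulrC.
  apply/eqP => Pi0; have := congr1 (mulmxr (P^t*)) Pi0.
  rewrite /= -row_mul PPt mul0mx row1 => /matrixP/(_ 0 i)/eqP.
  by rewrite !mxE !eqxx oner_eq0.
pose w := P *m x; pose e := d - const_mx a.
have A_e : A - a%:M = P^t* *m diag_mx e *m P.
  rewrite linearB /= diag_const_mx mulmxBr mulmxBl -A_PdP.
  by rewrite mul_mx_scalar -scalemxAl PtP scalemx1.
have sum0 : \sum_i e 0 i * `|w i 0| ^+ 2 = 0.
  have : w^t* *m diag_mx e *m w = 0.
    transitivity (x^t* *m (A - a%:M) *m x).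
      by rewrite A_e trmx_mul map_mxM /= !mulmxA.
    by rewrite mulmxBr mulmxBl xAx mul_mx_scalar -scalemxAl subrr.
  by rewrite diag_quad_form => /matrixP/(_ 0 0); rewrite !mxE eqxx.
have e_ge0 i : 0 <= e 0 i by rewrite !mxE subr_ge0.
have ew0 : diag_mx e *m w = 0.
  have term_ge0 k (_ : true) : 0 <= e 0 k * `|w k 0| ^+ 2.
    by rewrite mulr_ge0 // exprn_ge0.
  apply/matrixP => i j; rewrite ord1 mul_diag_mx !mxE.
  have /eqP : e 0 i * `|w i 0| ^+ 2 = 0 by exact: (psumr_eq0P term_ge0 sum0).
  by rewrite mulf_eq0 expf_eq0 normr_eq0 -mulf_eq0 !mxE => /eqP.
by apply/eqP; rewrite -subr_eq0 -mul_scalar_mx -mulmxBl A_e -!mulmxA ew0 mulmx0.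
Qed.

(** The quadratic form of diag v at the constant vector is the trace of diag v,
    which isospectrality forces to be 0. *)
Lemma diag_perturbation_isospectral (C : numClosedFieldType) (n : nat)
    (A : 'M[C]_n) (v : 'rV[C]_n) (a : C) :
    A \is hermsymmx -> v \is a realmx -> lowest_eigenvalue A a ->
    eigenvector A a (const_mx 1) -> isospectral A (A + diag_mx v) ->
  v = 0.
Proof.
move=> A_herm v_real [_ a_min] [_ A1] iso.
have trv0 : \tr (diag_mx v) = 0.
  by apply: (addrI (\tr A)); rewrite -mxtraceD -(isospectral_trace iso) addr0.
have B_herm : A + diag_mx v \is hermsymmx.
  apply/is_hermitianmxP; rewrite expr0 scale1r.
  rewrite [in RHS]linearD /= map_mxD tr_diag_mx map_diag_mx; congr (_ + _).
    by have /is_hermitianmxP := A_herm; rewrite expr0 scale1r.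
  congr diag_mx; apply/matrixP => i j; rewrite mxE.
  by have /mxOverP/(_ i j)/CrealP := v_real.
have B_min b : eigenvalue (A + diag_mx v) b -> a <= b.
  move=> Bb; apply: a_min; move: Bb.
  by rewrite !eigenvalue_root_char (isospectral_char_poly iso).
have B1 : (A + diag_mx v) *m const_mx 1 = a *: const_mx 1 :> 'cV_n.
  apply: hermitian_rayleigh_min => //.
  rewrite mulmxDr mulmxDl diag_quad_form.
  under eq_bigr do rewrite mxE normr1 expr1n mulr1.
  by rewrite -mxtrace_diag trv0 raddf0 addr0 -mulmxA A1 -scalemxAr.
apply/matrixP => i j; rewrite ord1.
move/matrixP/(_ j 0): B1; rewrite mulmxDl A1 mul_diag_mx !mxE.
by rewrite !mulr1 -[RHS]addr0 => /addrI.
Qed.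

End Hermitian.

Theorem theorem4 (R : realType) (n : nat) (n_ge1 : (1 <= n)%N)
    (H0 H : 'M[R[i]]_n) (v : 'rV[R]_n) (V : 'M[R]_n)
    (H0_herm : H0 \is hermsymmx)
    (V_diag : V = diag_mx v)
    (H_def : H = H0 + map_mx (real_complex R) V)
    (H0_nonneg : exists s : R,
       0 < s /\ (s%:C)%:M - H0 \is a mxOver Num.nneg)
    (H0_one : exists a : R[i],
       lowest_eigenvalue H0 a /\ eigenvector H0 a (const_mx 1)) :
  isospectral H0 H <-> V = 0.
Proof.
split=> [iso | V0]; last by move=> b; rewrite H_def V0 map_mx0 addr0.
case: H0_one => a [a_low a_one].
move: iso; rewrite H_def V_diag map_diag_mx => iso.
have vC_real : map_mx (real_complex R) v \is a realmx.
  apply/mxOverP => i j; rewrite mxE.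
  by apply/complex_realP; exists (v i j).
have v0 := diag_perturbation_isospectral H0_herm vC_real a_low a_one iso.
have -> : v = 0.
  by apply: (map_mx_inj (f := real_complex R)); rewrite v0 map_mx0.
exact: linear0.
Qed.
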